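(* Let $0<\underline\lambda\le\bar\lambda$ and let $\{\mathcal G\}_{[\underline\lambda,\bar\lambda]}$ be the set of all connected undirected weighted graphs whose smallest and largest nonzero Laplacian eigenvalues $\lambda_2,\lambda_N$ satisfy $[\lambda_2,\lambda_N]\subseteq[\underline\lambda,\bar\lambda]$. For an integer $M\ge1$ and real parameters $\alpha$ and $\Theta_M=[\theta_0,\dots,\theta_M]$ with $\sum_{m=0}^M\theta_m=0$, consider on graphs $\mathcal G\in\{\mathcal G\}_{[\underline\lambda,\bar\lambda]}$ the multi-agent system $$x_i(k+1)=x_i(k)+u_i(k),\qquad u_i(k)=\alpha\sum_{j\in\mathcal N_i}a_{ij}(x_j(k)-x_i(k))+\sum_{m=0}^{M}\theta_m x_i(k-m),\quad i=1,\dots,N,$$ and the worst-case convergence rate $$\gamma_M=\sup_{\mathcal G\in\{\mathcal G\}_{[\underline\lambda,\bar\lambda]}}\ \max_{i=1,\dots,N}\bar r(h_i(z)).$$ Then for any $M\ge1$ the solution of the optimization problem $\min_{\{\alpha,\Theta_M\}}\gamma_M$ (minimum over real $\alpha,\theta_0,\dots,\theta_M$ with $\sum_{m=0}^M\theta_m=0$) is as follows: the optimal value is $$\gamma_M^*=\frac{\sqrt{\bar\lambda/\underline\lambda}-1}{\sqrt{\bar\lambda/\underline\lambda}+1},$$ and the corresponding optimal parameters are $$\alpha^*=\frac{4}{(\sqrt{\bar\lambda}+\sqrt{\underline\lambda})^2},\qquad\theta_0^*=\left(\frac{\sqrt{\bar\lambda/\underline\lambda}-1}{\sqrt{\bar\lambda/\underline\lambda}+1}\right)^2,\qquad\theta_1^*=-\theta_0^*,\qquad\theta_m^*=0,\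 m=2,\dots,M.$$
   Context: A graph is undirected with adjacency matrix $\mathcal A=[a_{ij}]$, $a_{ii}=0$, $a_{ij}=a_{ji}>0$ iff $i$ and $j$ are adjacent (and $a_{ij}=0$ otherwise); $N\ge 2$ is its number of vertices and $\mathcal N_i$ is the set of neighbors of vertex $i$. The Laplacian is $\mathcal L=\mathcal D-\mathcal A$ with $\mathcal D=\mathrm{diag}(d_1,\dots,d_N)$, $d_i=\sum_j a_{ij}$; for a connected graph its eigenvalues are $0=\lambda_1<\lambda_2\le\cdots\le\lambda_N$. For given $\mathcal G$, $\alpha$, $\theta_0,\dots,\theta_M$ the polynomials are $$h_1(z)=z^M-\theta_0z^{M-1}-(\theta_0+\theta_1)z^{M-2}-\cdots-\Big(\sum_{m=0}^{M-1}\theta_m\Big),$$ $$h_i(z)=z^{M+1}-(1+\theta_0-\alpha\lambda_i)z^M-\sum_{m=1}^{M}\theta_m z^{M-m},\quad i=2,\dots,N,$$ and $\bar r(h)$ denotes the maximum modulus of the roots of $h$. ''Optimal parameters'' means parameters at which the minimum is attained. *)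

(* Defs.v *)
From HB Require Import structures.
From mathcomp Require Import all_boot all_order all_algebra.
From mathcomp Require Import complex.
From mathcomp Require Import all_classical all_reals all_analysis.

Set Implicit Arguments.
Unset Strict Implicit.
Unset Printing Implicit Defensive.

Import Order.TTheory GRing.Theory Num.Theory.
Local Open Scope classical_set_scope.
Local Open Scope ring_scope.

Section Roots.
Variable R : realType.

(* All complex roots of a nonzero real polynomial, listed with multiplicity. *)
Definition croots (p : {poly R}) : seq R[i] :=
  sval (closed_field_poly_normal (map_poly (real_complex R) p)).

Definition rbar (p : {poly R}) : R :=
  \big[Num.max/0]_(z <- croots p) ComplexField.Normc.normc z.

End Roots.

(* Undirected graph on 'I_N given by its weighted adjacency matrix; distinct
   vertices are adjacent exactly when their weight is positive. *)
Record wgraph (R : realType) (N : nat) := WGraph {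
  adj : 'M[R]_N;
  adj_diag : forall i, adj i i = 0;
  adj_sym : forall i j, adj i j = adj j i;
  adj_ge0 : forall i j, 0 <= adj i j
}.

Section Graphs.
Variables (R : realType) (N : nat).
Implicit Types G : wgraph R N.

Definition adjacent G : rel 'I_N := fun i j => 0 < adj G i j.

Definition connected_graph G : Prop := forall i j, connect (adjacent G) i j.

Definition laplacian G : 'M[R]_N :=
  diag_mx (\row_i \sum_j adj G i j) - adj G.

(* Eigenvalues with multiplicity in nondecreasing order. The Laplacian is real
   symmetric, so the roots of its characteristic polynomial are real and taking
   real parts loses nothing. *)
Definition laplacian_spectrum G : seq R :=
  sort <=%R [seq complex.Re z | z <- croots (char_poly (laplacian G))].

(* Indices start at 0: [eigval G 0] is lambda_1, [eigval G N.-1] is lambda_N. *)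
Definition eigval G (i : nat) : R := (laplacian_spectrum G)`_i.

Definition in_family (lmin lmax : R) G : Prop :=
  connected_graph G /\
  `[eigval G 1, eigval G N.-1] `<=` `[lmin, lmax].

End Graphs.

Section Rate.
Variables (R : realType) (M : nat).
Implicit Types (alpha lambda : R) (Theta : 'rV[R]_M.+1).

Definition h_first Theta : {poly R} :=
  'X^M - \sum_(1 <= k < M.+1)
           (\sum_(m < M.+1 | (m < k)%N) Theta ord0 m) *: 'X^(M - k).

Definition h_other alpha Theta lambda : {poly R} :=
  'X^(M.+1) - (1 + Theta ord0 ord0 - alpha * lambda) *: 'X^M
  - \sum_(m < M.+1 | (0 < m)%N) Theta ord0 m *: 'X^(M - m).

Definition h_poly alpha Theta N (G : wgraph R N) (i : 'I_N) : {poly R} :=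
  if i == 0%N :> nat then h_first Theta
  else h_other alpha Theta (eigval G i).

Definition graph_rate alpha Theta N (G : wgraph R N) : R :=
  \big[Num.max/0]_(i < N) rbar (h_poly alpha Theta G i).

(* The supremum ranges over graphs of every size N >= 2 and is taken in the
   extended reals, so that no boundedness assumption is hidden in it. *)
Definition gamma (lmin lmax alpha : R) Theta : \bar R :=
  ereal_sup [set r | exists N (G : wgraph R N),
    [/\ (2 <= N)%N, in_family lmin lmax G
      & r = (graph_rate alpha Theta G)%:E]].

Definition feasible Theta : Prop := \sum_m Theta ord0 m = 0.

Definition optimal (lmin lmax alpha : R) Theta : Prop :=
  feasible Theta /\
  forall alpha' Theta', feasible Theta' ->
    (gamma lmin lmax alpha Theta <= gamma lmin lmax alpha' Theta')%E.

End Rate.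

Section OptimalValues.
Variable R : realType.
Implicit Types lmin lmax : R.

Definition gamma_star lmin lmax : R :=
  (Num.sqrt (lmax / lmin) - 1) / (Num.sqrt (lmax / lmin) + 1).

Definition alpha_star lmin lmax : R :=
  4 / (Num.sqrt lmax + Num.sqrt lmin) ^+ 2.

Definition theta0_star lmin lmax : R :=
  ((Num.sqrt (lmax / lmin) - 1) / (Num.sqrt (lmax / lmin) + 1)) ^+ 2.

Definition Theta_star (M : nat) lmin lmax : 'rV[R]_M.+1 :=
  \row_(m < M.+1) (if m == 0%N :> nat then theta0_star lmin lmax
                   else if m == 1%N :> nat then - theta0_star lmin lmax
                   else 0).

End OptimalValues.

(* Main.v *)
(* Write c = gamma_star and k = alpha_star.  Up to a factor, h_lambda(z) is
   W(z) - lambda with W(z) = - (z - 1) h_1(z) / (alpha z^M).  The optimal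
   W'(w) = - (w - 1) (w - c^2) / (k w) is a Joukowski map sending the circle
   |w| = c onto [lmin, lmax], so if all roots of all h_lambda lie in |z| <= c,
   then W avoids [lmin, lmax] on |z| > c, and solving W(z) = W'(w) with |w| > c
   gives a self-map z |-> w of |z| > c fixing 1, to which the equality case of
   the Schwarz lemma applies.  The Schwarz lemma is replaced here by a homotopy:
   for s in [0, 1] consider the solutions of W(w / s) = W'(w) with |w| >= c,
   which are the roots in |eta| <= 1 / c of the polynomials

     Q_s(eta) = alpha s (1 - eta) (1 - c^2 eta) - k g(s eta),   eta = 1 / w,

   where g is the reversal of (z - 1) h_1(z).  Q_1 has the root 1, Q_0 is a
   nonzero constant, and no root crosses the circle |eta| = 1 / c for
   0 < s < 1, which is only possible when Q_1 = 0, that is, when the parameters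
   are the optimal ones.  For c = 0 the circle disappears, but then
   g + (alpha / k) X has no root at all, hence is constant. *)

Require Import Defs.
From mathcomp Require Import all_boot all_order all_algebra complex.
From mathcomp Require Import all_classical all_reals all_analysis.
From mathcomp Require Import lra ring.

Set Implicit Arguments.
Unset Strict Implicit.
Unset Printing Implicit Defensive.

Import Order.TTheory GRing.Theory Num.Theory.
Local Open Scope complex_scope.
Local Open Scope ring_scope.

Import ComplexField.Normc.

Local Notation toC := (map_poly (real_complex _)).

(** * Complex roots: moduli, growth estimates and the homotopy argument *)

Section Roots.
Variable R : realType.
Implicit Types (p : {poly R[i]}) (z : R[i]) (r : R).

Lemma normc_ge0 z : 0 <= normc z.
Proof. by case: z => a b; exact: sqrtr_ge0. Qed.

Lemma normcB z w : normc (z - w) = normc (w - z).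
Proof. by rewrite -normcN opprB. Qed.

Lemma normc_real r : normc r%:C = `|r|.
Proof. by rewrite /= expr0n addr0 sqrtr_sqr. Qed.

Lemma mem_croots (q : {poly R}) z : q != 0 ->
  (z \in croots q) = root (toC q) z.
Proof.
move=> q0; rewrite /croots; case: closed_field_poly_normal => s /= E;
  rewrite [in RHS]E.
by rewrite rootZ ?root_prod_XsubC// lead_coef_eq0 map_poly_eq0.
Qed.

Lemma rbar_le (q : {poly R}) r : q != 0 -> 0 <= r ->
  (forall z, root (toC q) z -> normc z <= r) ->
  rbar q <= r.
Proof.
move=> q0 r0 h; rewrite /rbar big_seq.
elim/big_ind: _ => // [x y hx hy|z]; first by rewrite ge_max hx.
by rewrite mem_croots// => /h.
Qed.

Lemma normc_le_rbar (q : {poly R}) z : q != 0 ->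
  root (toC q) z -> normc z <= rbar q.
Proof.
move=> q0; rewrite -mem_croots// /rbar.
elim: (croots q) => // w s IH;
  rewrite inE big_cons le_max => /orP[/eqP->|/IH->].
  by rewrite lexx.
by rewrite orbT.
Qed.

(* Each factor satisfies
   [|z1 - w| <= |z0 - w| + |z1 - z0| <= |z0 - w| (1 + |z1 - z0| / r)]. *)
Lemma horner_le_of_roots_far p z0 z1 r d : 0 < r -> (size p <= d.+1)%N ->
  (forall w, root p w -> r <= normc (w - z0)) ->
  normc p.[z1] <= normc p.[z0] * (1 + normc (z1 - z0) / r) ^+ d.
Proof.
move=> r0 sp far.
set c := 1 + _.
have c1 : 1 <= c by rewrite lerDl divr_ge0 ?normc_ge0 ?ltW.
have c0 : 0 <= c by exact: le_trans c1.
have [->|p0] := eqVneq p 0; first by rewrite !horner0 normc0 mul0r.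
have [s ps] := closed_field_poly_normal p.
have lc : lead_coef p != 0 by rewrite lead_coef_eq0.
have hs : forall w, w \in s -> r <= normc (w - z0).
  by move=> w ws; apply: far; rewrite ps rootZ// root_prod_XsubC.
have ss : (size s <= d)%N.
  by move: sp; rewrite ps size_scale// size_prod_XsubC.
rewrite ps !hornerZ !normcM -mulrA ler_wpM2l ?normc_ge0// !horner_prod.
have : normc (\prod_(w <- s) ('X - w%:P).[z1])
    <= normc (\prod_(w <- s) ('X - w%:P).[z0]) * c ^+ size s.
  elim: s hs {ps ss} => [_|w s IH hs].
    by rewrite !big_nil normc1 mulr1.
  rewrite !big_cons !normcM exprS mulrACA ler_pM ?normc_ge0//.
    rewrite !hornerXsubC.
    have hw : r <= normc (z0 - w) by rewrite normcB hs ?mem_head.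
    rewrite /c mulrDr mulr1 mulrCA.
    apply: (le_trans (y := normc (z0 - w) + normc (z1 - z0))).
      rewrite [leRHS]addrC; apply: le_trans (le_normcD _ _).
      by rewrite addrA subrK.
    by rewrite lerD2l ler_peMr ?normc_ge0// ler_pdivlMr ?mul1r.
  by apply: IH => v vs; apply: hs; rewrite inE vs orbT.
by move/le_trans; apply; rewrite ler_wpM2l ?normc_ge0// ler_weXn2l.
Qed.

Lemma roots_outside_gap p r : p != 0 ->
  (forall z, normc z <= r -> ~~ root p z) ->
  exists2 e, 0 < e & forall z, root p z -> r + e <= normc z.
Proof.
move=> p0 h; have [s ps] := closed_field_poly_normal p.
have rE z : root p z = (z \in s).
  by rewrite ps rootZ ?lead_coef_eq0// root_prod_XsubC.
have {}h z : z \in s -> r < normc z.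
  by move=> zs; rewrite ltNge; apply/negP => /h; rewrite rE zs.
have [e e0 he] : exists2 e, 0 < e & forall z, z \in s -> r + e <= normc z.
  elim: s h {ps rE} => [|w s IH] h; first by exists 1.
  have [|e e0 he] := IH; first by move=> z zs; apply: h; rewrite inE zs orbT.
  exists (Num.min e (normc w - r)).
    by rewrite lt_min e0 subr_gt0 h ?mem_head.
  move=> z; rewrite inE -lerBrDl ge_min => /orP[/eqP->|/he].
    by rewrite lexx orbT.
  by rewrite -lerBrDl => ->.
by exists e => // z; rewrite rE; exact: he.
Qed.

(** Used to check the Lipschitz hypothesis of [root_homotopy]. The induction carries a bound [L] on
    the values along with the Lipschitz constant, as the product rule requires. *)
Lemma horner_lipschitz p (B : R) : 0 <= B -> exists2 K, 0 <= K &
  forall z w, normc z <= B -> normc w <= B ->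
    normc (p.[z] - p.[w]) <= K * normc (z - w).
Proof.
move=> B0.
suff [K [L [K0 L0 h]]] : exists K L, [/\ 0 <= K, 0 <= L &
    forall z w, normc z <= B -> normc w <= B ->
    normc p.[w] <= L /\ normc (p.[z] - p.[w]) <= K * normc (z - w)].
  by exists K => // z w hz hw; case: (h z w hz hw).
elim/poly_ind: p => [|p c [K [L [K0 L0 h]]]].
  by exists 0, 0; split=> // z w _ _; rewrite !horner0 subr0 mul0r normc0.
exists (K * B + L), (L * B + normc c); split.
- by rewrite addr_ge0 ?mulr_ge0.
- by rewrite addr_ge0 ?mulr_ge0 ?normc_ge0.
move=> z w hz hw; have [hp hl] := h z w hz hw.
rewrite !hornerMXaddC; split.
  by apply: le_trans (le_normcD _ _) _; rewrite lerD2r normcM ler_pM ?normc_ge0.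
have -> : p.[z] * z + c - (p.[w] * w + c)
        = (p.[z] - p.[w]) * z + p.[w] * (z - w) by ring.
apply: le_trans (le_normcD _ _) _; rewrite !normcM mulrDl lerD//.
  by rewrite mulrAC ler_pM ?normc_ge0.
by rewrite ler_wpM2r ?normc_ge0.
Qed.

Lemma le0_of_small (a K e0 : R) : 0 < e0 -> 0 <= K ->
  (forall e, 0 < e -> e <= e0 -> a <= K * e) -> a <= 0.
Proof.
move=> e00 K0 h; rewrite leNgt; apply/negP => a0.
set e := Num.min e0 (a / (2 * (K + 1))).
have K1 : 0 < 2 * (K + 1) by lra.
have e_gt0 : 0 < e by rewrite lt_min e00 divr_gt0.
have /(h _ e_gt0) : e <= e0 by rewrite ge_min lexx.
have : e * (2 * (K + 1)) <= a by rewrite -ler_pdivlMr// ge_min lexx orbT.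
by have := mulr_ge0 K0 (ltW e_gt0); nra.
Qed.

(* The infimum of the parameters having a root in the disc is such a parameter
   and cannot be positive: just below it all roots would stay away from an
   interior root, which by [horner_le_of_roots_far] kills the polynomial. *)
Lemma root_homotopy (Q : R -> {poly R[i]}) d r z1 : 0 < r ->
  (forall s, (size (Q s) <= d.+1)%N) ->
  (forall B : R, 0 <= B -> exists2 K : R, 0 <= K & forall (s t : R) z,
    0 <= s <= 1 -> 0 <= t <= 1 -> normc z <= B ->
    normc ((Q s).[z] - (Q t).[z]) <= K * `|s - t|) ->
  (forall z, normc z <= r -> ~~ root (Q 0) z) ->
  (forall (s : R) z, 0 < s < 1 -> normc z = r -> ~~ root (Q s) z) ->
  normc z1 < r -> root (Q 1) z1 -> forall z, root (Q 1) z.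
Proof.
move=> r0 sQ lip Q0 Qb hz1 Q1.
pose T : set R := [set s : R | 0 <= s <= 1 /\
  exists2 z, normc z <= r & root (Q s) z]%classic.
have T1 : T 1 by split; rewrite ?ler01 ?lexx//; exists z1 => //; exact: ltW.
have lbT : has_lbound T by exists 0 => s [/andP[]].
have infT : has_inf T by split => //; exists 1.
set s0 := inf T.
have s0_ge0 : 0 <= s0 by apply: lb_le_inf => [|s [/andP[]]//]; exists 1.
have s0_le1 : s0 <= 1 by exact: ge_inf.
have s01 : 0 <= s0 <= 1 by rewrite s0_ge0.
(* Otherwise the roots of [Q s0] keep a distance [e] from the disc, while some [s] arbitrarily close
   to [s0] has a root [z] in it, where [Q s0] is small; the growth estimate centred at [z] then
   forces [Q s0] to vanish at 0. *)
have Ts0 : T s0.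
  split => //; apply: contrapT => hT.
  have hN z : normc z <= r -> ~~ root (Q s0) z.
    by move=> hz; apply/negP => rz; apply: hT; exists z.
  have Qs0 : Q s0 != 0.
    by apply: contraTneq (root0 (0 : R[i])) => <-; apply: hN;
      rewrite normc0 ltW.
  have [e e0 he] := roots_outside_gap Qs0 hN.
  have [K K0 hK] := lip r (ltW r0).
  have /negP : ~~ root (Q s0) 0 by apply: hN; rewrite normc0 ltW.
  apply.
  apply/rootP/eq0_normc/le_anti; rewrite normc_ge0 andbT.
  apply: (@le0_of_small _ (K * (1 + r / e) ^+ d) 1) => //.
    by rewrite mulr_ge0// exprn_ge0// addr_ge0// divr_ge0 ?ltW.
  move=> x x0 _; have [s Ts sx] := inf_adherent x0 infT.
  have ss0 : s0 <= s by exact: ge_inf.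
  case: Ts => s1 [z hz rz].
  have far w : root (Q s0) w -> e <= normc (w - z).
    move=> /he hw; have := le_normcD (w - z) z; rewrite subrK => hh.
    by rewrite -(lerD2l r) (le_trans hw)// (le_trans hh)// addrC lerD2r.
  apply: le_trans (horner_le_of_roots_far 0 e0 (sQ s0) far) _.
  rewrite mulrAC ler_pM ?normc_ge0//.
  - by rewrite exprn_ge0// addr_ge0// divr_ge0 ?normc_ge0 ?ltW.
  - have := hK s0 s z s01 s1 hz; rewrite (rootP rz) subr0 => /le_trans; apply.
    rewrite ler_wpM2l// distrC ger0_norm ?subr_ge0// lerBlDl.
    exact: ltW.
  - have hze : 1 + normc (0 - z) / e <= 1 + r / e.
      by rewrite lerD2l ler_pM2r ?invr_gt0// sub0r normcN.
    have ze0 : 0 <= 1 + normc (0 - z) / e.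
      by rewrite addr_ge0// divr_ge0 ?normc_ge0 ?ltW.
    by apply: lerXn2r => //; rewrite nnegrE// (le_trans ze0).
have s0_gt0 : 0 < s0.
  rewrite lt_neqAle s0_ge0 andbT eq_sym; apply/eqP => s00.
  by case: Ts0 => _ [z /Q0/negP hz]; rewrite s00.
(* For [s0 = 1] the given [z1] serves; for [s0 < 1] the circle is excluded by [Qb]. *)
have [z0 hz0 rz0] : exists2 z0, normc z0 < r & root (Q s0) z0.
  have [s0_lt1|] := ltP s0 1; last first.
    by move=> h; exists z1 => //; have -> : s0 = 1 by apply/le_anti;
      rewrite s0_le1.
  case: Ts0 => _ [z hz rz]; exists z => //.
  rewrite lt_neqAle hz andbT; apply/eqP => zr.
  by have /negP := Qb _ _ (introT andP (conj s0_gt0 s0_lt1)) zr; apply.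
(* All roots of [Q (s0 - e)] are at distance at least [r - |z0|] from [z0]. Its value at [z0] is
   O(e), hence so is its value at any [z], and so is that of [Q s0]. *)
have Q00 z : root (Q s0) z.
  apply/rootP/eq0_normc/le_anti; rewrite normc_ge0 andbT.
  have e0 : 0 < r - normc z0 by rewrite subr_gt0.
  have [K K0 hK] := lip _ (addr_ge0 (normc_ge0 z0) (normc_ge0 z)).
  set C := (1 + normc (z - z0) / (r - normc z0)) ^+ d.
  have C0 : 0 <= C by rewrite exprn_ge0// addr_ge0// divr_ge0 ?normc_ge0 ?ltW.
  apply: (@le0_of_small _ (K + K * C) s0) => //.
    by rewrite addr_ge0 ?mulr_ge0.
  move=> e e_gt0 es.
  have se1 : 0 <= s0 - e <= 1.
    by rewrite subr_ge0 es lerBlDr (le_trans s0_le1)// lerDl ltW.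
  have far w : root (Q (s0 - e)) w -> r - normc z0 <= normc (w - z0).
    move=> rw; rewrite lerBlDr; apply: (le_trans (y := normc w)).
      rewrite leNgt; apply/negP => wr.
      have /(ge_inf lbT) : T (s0 - e) by split=> //; exists w => //; exact: ltW.
      by rewrite -/s0 lerBrDr gerDl leNgt e_gt0.
    by rewrite -{1}(subrK z0 w) le_normcD.
  have := horner_le_of_roots_far z e0 (sQ _) far; rewrite -/C => hC.
  have ne : `|s0 - (s0 - e)| = e by rewrite opprB addrC subrK gtr0_norm.
  have h1 := hK _ _ z s01 se1 _; rewrite ne in h1.
  have h2 := hK _ _ z0 s01 se1 _; rewrite ne (rootP rz0) sub0r normcN in h2.
  rewrite -(subrK (Q (s0 - e)).[z] (Q s0).[z]).
  apply: le_trans (le_normcD _ _) _.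
  rewrite mulrDl lerD ?h1 ?lerDr ?normc_ge0//.
  by rewrite mulrAC (le_trans hC)// ler_wpM2r// h2 ?lerDl ?normc_ge0.
have [s0_lt1|] := ltP s0 1; last first.
  by move=> h; have <- : s0 = 1 by apply/le_anti; rewrite s0_le1.
(* If [s0 < 1], the vanishing [Q s0] would have the root [r] on the circle. *)
have : ~~ root (Q s0) r%:C.
  by apply: Qb; rewrite ?s0_gt0 ?s0_lt1// normc_real gtr0_norm.
by rewrite Q00.
Qed.

End Roots.

(** The images of the naturals below [size p] are already too many distinct roots. *)
Lemma eq0_of_all_roots (F : numDomainType) (p : {poly F}) :
  (forall x, root p x) -> p = 0.
Proof.
move=> h; apply/eqP; apply: contraT => p0.
have := @max_poly_roots _ p [seq i%:R | i <- iota 0 (size p)] p0.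
rewrite size_map size_iota ltnn; apply.
  by apply/allP => x _; exact: h.
by rewrite map_inj_uniq ?iota_uniq// => i j /eqP; rewrite eqr_nat => /eqP.
Qed.

(** * Rigidity: small roots over the whole eigenvalue interval determine the parameters *)

Section Rigidity.
Variables (R : realType) (M : nat).
Implicit Types (alpha lambda : R) (Theta : 'rV[R]_M.+1).

Lemma h_other_coef_lead alpha Theta lambda :
  (h_other alpha Theta lambda)`_M.+1 = 1.
Proof.
rewrite /h_other !coefB coefZ !coefXn eqxx gtn_eqF// mulr0 subr0 coef_sum.
rewrite big1 ?subr0// => i _; rewrite coefZ coefXn gtn_eqF ?mulr0//.
by rewrite ltnS leq_subr.
Qed.

Lemma h_other_neq0 alpha Theta lambda : h_other alpha Theta lambda != 0.
Proof.
by apply: contra_neq (oner_neq0 R) => h;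
  rewrite -(h_other_coef_lead alpha Theta lambda) h coef0.
Qed.

(* [z^(M+1) (z^-1 - 1) h_1(z^-1)] when [Theta] is feasible; the [h_i] are, up to
   reversal, the perturbations [rev_first Theta + alpha lambda_i z]. *)
Definition rev_first Theta : {poly R} :=
  1 - (1 + Theta ord0 ord0) *: 'X
  - \sum_(m < M.+1 | (0 < m)%N) Theta ord0 m *: 'X^(m.+1).

Lemma h_other_rev alpha Theta lambda (w : R[i]) : w != 0 ->
  (toC (h_other alpha Theta lambda)).[w^-1] * w ^+ M.+1 =
  (toC (rev_first Theta)).[w] + (alpha * lambda)%:C * w.
Proof.
move=> w0; rewrite /h_other /rev_first !rmorphB /= !hornerE_comm.
rewrite !rmorph_sum /= !map_polyZ !map_polyXn map_polyX rmorph1 !hornerE.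
rewrite !horner_sum !mulrBl -exprMn mulVf// expr1n mulr_suml.
rewrite exprS [_ * (w * _)]mulrCA -!mulrA -exprMn mulVf// expr1n mulr1.
rewrite [RHS]addrAC; congr (_ - _); last first.
  apply: eq_bigr => m m0;
    rewrite !map_polyZ !map_polyXn !hornerZ !hornerXn -mulrA; congr (_ * _).
  have mM : (m <= M)%N by rewrite -ltnS.
  rewrite -exprS -[in X in _ ^+ X.+1](subnK mM) -addnS exprD mulrA -exprMn.
  by rewrite mulVf// expr1n mul1r.
by ring.
Qed.

Lemma root_h_other alpha Theta lambda (w : R[i]) : w != 0 ->
  (toC (rev_first Theta)).[w] + (alpha * lambda)%:C * w = 0 ->
  root (toC (h_other alpha Theta lambda)) w^-1.
Proof.
move=> w0 h; have /eqP := h_other_rev alpha Theta lambda w0.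
by rewrite h mulf_eq0 expf_eq0 (negPf w0) orbF.
Qed.

Lemma rev_first_at1 Theta : feasible Theta -> (rev_first Theta).[1] = 0.
Proof.
rewrite /feasible (bigD1 ord0)//= => h.
rewrite /rev_first !hornerE horner_sum.
have -> : \sum_(m < M.+1 | (0 < m)%N) (Theta ord0 m *: 'X^(m.+1)).[1]
   = \sum_(m < M.+1 | m != ord0) Theta ord0 m.
  apply: eq_big => [m|m _]; first by rewrite lt0n.
  by rewrite !hornerZ hornerXn expr1n mulr1.
by rewrite opprD addrA subrr add0r -opprD h oppr0.
Qed.

Lemma rev_first_coef0 Theta : (rev_first Theta)`_0 = 1.
Proof.
rewrite /rev_first !coefB coef1 coefZ coefX mulr0 subr0 coef_sum big1 ?subr0//.
by move=> m _; rewrite coefZ coefXn mulr0.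
Qed.

Lemma rev_first_coef1 Theta : (rev_first Theta)`_1 = - (1 + Theta ord0 ord0).
Proof.
rewrite /rev_first !coefB coef1 coefZ coefX mulr1 sub0r coef_sum big1 ?subr0//.
by move=> m m0; rewrite coefZ coefXn eqSS ltn_eqF ?mulr0.
Qed.

Lemma rev_first_coefS Theta (m : 'I_M.+1) : (0 < m)%N ->
  (rev_first Theta)`_m.+1 = - Theta ord0 m.
Proof.
move=> m0.
rewrite /rev_first !coefB coef1 coefZ coefX eqSS (gtn_eqF m0) mulr0 subr0 sub0r.
rewrite coef_sum (bigD1 m)//= coefZ coefXn eqxx mulr1 big1 ?addr0// =>
  j /andP[_ jm].
by rewrite coefZ coefXn eqSS eq_sym val_eqE (negPf jm) mulr0.
Qed.

Lemma rev_first_inj : injective rev_first.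
Proof.
move=> T1 T2 h; apply/rowP => m.
have [m0|m0] := posnP m.
  have -> : m = ord0 by exact: val_inj.
  have := rev_first_coef1 T1; rewrite h rev_first_coef1 => /oppr_inj/addrI.
  by [].
have := rev_first_coefS T1 m0; rewrite h rev_first_coefS// => /oppr_inj.
by [].
Qed.

(** On this circle [1 / z] is [c^2] times the conjugate of [z], so dividing the product by [z]
    leaves a real number: the Joukowski map flattens the circle to a segment. *)
Lemma circle_quadratic (c : R) (z : R[i]) : 0 < c -> normc z = c^-1 ->
  (1 - z) * (1 - (c ^+ 2)%:C * z)
  = (2 * c ^+ 2 * complex.Re z - (1 + c ^+ 2))%:C * z.
Proof.
case: z => a b c0 /= h.
have {}h : a ^+ 2 + b ^+ 2 = (c ^+ 2)^-1.
  by rewrite -exprVn -h sqr_sqrtr// addr_ge0 ?sqr_ge0.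
have hc : c ^+ 2 * (a ^+ 2 + b ^+ 2) = 1 by rewrite h divff// expf_neq0 ?gt_eqF.
apply/eqP; rewrite eq_complex /=; apply/andP; split; apply/eqP; first by lra.
by ring.
Qed.

Section Star.
Variables (k c alpha : R) (Theta : 'rV[R]_M.+1).
Hypotheses (k_gt0 : 0 < k) (c_ge0 : 0 <= c) (c_lt1 : c < 1).
Hypothesis Theta_feasible : feasible Theta.
(** For [k = alpha_star] and [c = gamma_star] this interval is [[lmin, lmax]], by [lminE] and
    [lmaxE]. *)
Hypothesis roots_small : forall lambda z,
  (1 - c) ^+ 2 / k <= lambda <= (1 + c) ^+ 2 / k ->
  root (toC (h_other alpha Theta lambda)) z -> normc z <= c.

(** The value of [rev_first] at the optimal parameters, see [rev_first_star]. *)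
Let quad : {poly R} := (1 - 'X) * (1 - (c ^+ 2) *: 'X).

(** A root [z] on the circle would make [1 / (s z)] a root of [h_other] for some [lambda] of the
    interval, yet its modulus [c / s] exceeds [c]. *)
Lemma no_circle_root (s : R) (z : R[i]) : 0 < c -> 0 < s < 1 ->
  normc z = c^-1 ->
  ((alpha * s)%:C *: toC quad
   - k%:C *: (toC (rev_first Theta) \Po (s%:C *: 'X))).[z] != 0.
Proof.
move=> c0 /andP[s0 s1] hz; apply/negP => /eqP.
(* Chosen so that [quad] takes the value [- lambda k z] at [z]. *)
pose lambda := (1 + c ^+ 2 - 2 * c ^+ 2 * complex.Re z) / k.
rewrite hornerD hornerN !hornerZ horner_comp hornerZ hornerX.
have -> : (toC quad).[z] = (- (lambda * k))%:C * z.
  rewrite /quad rmorphM !rmorphB /= rmorph1 map_polyX map_polyZ map_polyX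
    !hornerE.
  rewrite circle_quadratic//; congr (_%:C * _).
  by rewrite /lambda divfK ?gt_eqF// opprB.
move=> h.
have z0 : z != 0.
  by apply: contra_eq_neq hz => ->; rewrite normc0 eq_sym invr_eq0 gt_eqF.
have kC : k%:C != 0 :> R[i] by rewrite fmorph_eq0 gt_eqF.
have sC : s%:C != 0 :> R[i] by rewrite fmorph_eq0 gt_eqF.
have w0 : s%:C * z != 0 by rewrite mulf_neq0.
have /(root_h_other w0)/roots_small :
    (toC (rev_first Theta)).[s%:C * z] + (alpha * lambda)%:C * (s%:C * z) = 0.
  apply: (mulfI kC); rewrite mulr0.
  apply: oppr_inj; rewrite oppr0 -[RHS]h.
  rewrite !rmorphN !rmorphM /=; ring.
rewrite normcV normcM hz normc_real gtr0_norm// invfM invrK => hh.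
have /hh : (1 - c) ^+ 2 / k <= lambda <= (1 + c) ^+ 2 / k.
  (* With [x = c Re z] in [[-1, 1]], the value [lambda k = 1 + c^2 - 2 c x] lies between [(1 - c)^2]
     and [(1 + c)^2]. *)
  have : (c * complex.Re z) ^+ 2 <= 1.
    move: hz; case: (z) => a b /= /(congr1 (fun x => x ^+ 2)).
    rewrite sqr_sqrtr ?addr_ge0 ?sqr_ge0// => /(congr1 (fun x => c ^+ 2 * x)).
    rewrite exprVn divff ?expf_neq0 ?gt_eqF// => <-.
    by rewrite exprMn ler_wpM2l ?sqr_ge0// lerDl sqr_ge0.
  set x := c * complex.Re z => x1.
  have -> : lambda = (1 + c ^+ 2 - 2 * c * x) / k by rewrite /lambda /x; ring.
  by rewrite !ler_pM2r ?invr_gt0//; apply/andP; split; nra.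
by rewrite ger_pMl// invf_le1// leNgt s1.
Qed.

Lemma parameters_unique_gt0 : 0 < c -> alpha = k /\ rev_first Theta = quad.
Proof.
move=> c0.
have kC : k%:C != 0 :> R[i] by rewrite fmorph_eq0 gt_eqF.
pose Q (s : R) := (alpha * s)%:C *: toC quad
  - k%:C *: (toC (rev_first Theta) \Po (s%:C *: 'X)).
have Q0 z : ~~ root (Q 0) z.
  rewrite /root /Q mulr0 rmorph0 scale0r sub0r scale0r comp_polyCr.
  rewrite hornerN hornerZ hornerC oppr_eq0 mulf_neq0// horner_coef0 coef_map.
  by rewrite rev_first_coef0; exact: (oner_neq0 R[i]).
(* Both [quad] and, by feasibility, [rev_first Theta] vanish at 1. *)
have Q1 : root (Q 1) 1.
  rewrite /root /Q hornerD hornerN !hornerZ horner_comp hornerZ hornerX mulr1.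
  rewrite -(rmorph1 (real_complex R)) !horner_map -rmorphM mulr1 horner_map
    rev_first_at1//.
  have -> : quad.[1] = 0 by rewrite /quad hornerM hornerD hornerN hornerC
    hornerX subrr mul0r.
  by rewrite !rmorph0 !mulr0 subrr.
have szQ s : (size (Q s) <= (maxn (size quad) (size (rev_first Theta))).+1)%N.
  rewrite (leq_trans (size_polyD _ _))// size_polyN geq_max; apply/andP; split.
    by rewrite (leq_trans (size_scale_leq _ _))// size_map_poly leqW// leq_maxl.
  rewrite (leq_trans (size_scale_leq _ _))//.
  rewrite (leq_trans (size_comp_poly_leq _ _))// ltnS size_map_poly.
  apply: leq_trans (leq_maxr _ _); apply: leq_trans (leq_pred _).
  rewrite -[leqRHS]muln1 leq_mul2l; apply/orP; right.
  by rewrite -subn1 leq_subLR (leq_trans (size_scale_leq _ _))// size_polyX.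
have lipQ B : 0 <= B -> exists2 K : R, 0 <= K & forall (s t : R) z,
    0 <= s <= 1 -> 0 <= t <= 1 -> normc z <= B ->
    normc ((Q s).[z] - (Q t).[z]) <= K * `|s - t|.
  move=> B0.
  have [L L0 hL] := horner_lipschitz (toC quad) B0.
  have [L' L'0 hL'] := horner_lipschitz (toC (rev_first Theta)) B0.
  (* The first term bounds [quad] on the disc through its value at 0; the second uses that [s z] and
     [t z] are at distance at most [B |s - t|]. *)
  exists (`|alpha| * (L * B + normc (toC quad).[0]) + k * (L' * B)).
    by rewrite addr_ge0 ?mulr_ge0 ?addr_ge0 ?mulr_ge0 ?normc_ge0 ?(ltW k_gt0).
  move=> s t z /andP[s0 s1] /andP[t0 t1] hz.
  have hzB (u : R) : 0 <= u -> u <= 1 -> normc (u%:C * z) <= B.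
    move=> u0 u1; rewrite normcM normc_real ger0_norm//.
    by rewrite (le_trans _ hz)// ler_piMl ?normc_ge0.
  have -> : (Q s).[z] - (Q t).[z] = (alpha * (s - t))%:C * (toC quad).[z]
     + - (k%:C * ((toC (rev_first Theta)).[s%:C * z]
                  - (toC (rev_first Theta)).[t%:C * z])).
    rewrite /Q !hornerD !hornerN !hornerZ !horner_comp !hornerZ !hornerX.
    by ring.
  apply: le_trans (le_normcD _ _) _; rewrite normcN !normcM !normc_real normrM.
  rewrite mulrDl lerD//.
    rewrite mulrAC ler_wpM2r// ler_wpM2l//.
    rewrite -[X in normc X](subrK (toC quad).[0]) (le_trans (le_normcD _ _))//.
    rewrite lerD2r (le_trans (hL z 0 hz _)) ?normc0// subr0.
    by rewrite ler_wpM2l.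
  rewrite (gtr0_norm k_gt0) -!mulrA ler_wpM2l ?(ltW k_gt0)//.
  rewrite (le_trans (hL' _ _ (hzB _ s0 s1) (hzB _ t0 t1)))// ler_wpM2l//.
  by rewrite -mulrBl -rmorphB normcM normc_real mulrC ler_wpM2r.
have QE : Q 1 = 0.
  apply: eq0_of_all_roots.
  (* The known root 1 is interior to the disc of radius [1 / c] since [c < 1]. *)
  apply: (root_homotopy (z1 := 1) (r := c^-1) _ szQ lipQ) => //.
  - by rewrite invr_gt0.
  - by move=> s z s01 hz; exact: no_circle_root.
  - by rewrite normc1 invf_gt1.
have qk : alpha *: quad = k *: rev_first Theta.
  apply: (map_poly_inj (real_complex R)); apply/eqP.
  rewrite -subr_eq0 !map_polyZ -[X in _ == X]QE /Q mulr1.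
  by rewrite scale1r comp_polyXr.
have ak : alpha = k.
  have /(congr1 (fun p : {poly R} => p`_0)) := qk.
  rewrite !coefZ rev_first_coef0 -horner_coef0 /quad hornerM !hornerD !hornerN.
  by rewrite hornerZ !hornerC !hornerX mulr0 !subr0 !mulr1.
by split=> //; apply: (scalerI (negbT (gt_eqF k_gt0))); rewrite -qk ak.
Qed.

(** With [c = 0] the interval is the single point [1 / k], where [h_other] can only have the root 0;
    its reversal [P] then has no root and is constant. *)
Lemma parameters_unique_eq0 : c = 0 -> alpha = k /\ rev_first Theta = quad.
Proof.
move=> c0.
pose P : {poly R} := rev_first Theta + (alpha / k) *: 'X.
have P0 : P.[0] = 1.
  by rewrite horner_coef0 coefD rev_first_coef0 coefZ coefX mulr0 addr0.
have PE : P = 1.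
  have nr z : ~~ root (toC P) z.
    have [->|z0] := eqVneq z 0.
      by rewrite /root -(rmorph0 (real_complex R)) horner_map /= P0 rmorph1
        oner_neq0.
    apply/negP => /rootP;
      rewrite /P rmorphD /= map_polyZ map_polyX hornerD hornerZ hornerX.
    move=> /(root_h_other z0)/roots_small.
    rewrite c0 subr0 addr0 expr1n mul1r lexx => /(_ isT).
    rewrite normcV leNgt invr_gt0 lt_neqAle normc_ge0 andbT eq_sym.
    by move=> /negP[]; apply: contra_neq z0; exact: eq0_normc.
  have := closed_rootP (toC P); rewrite size_map_poly.
  have [/size_poly1P[a a0 Pa] _|_ H] := boolP (size P == 1%N).
    by move: P0; rewrite Pa hornerC => ->.
  by have [z] := elimT H isT; rewrite (negPf (nr z)).
(* Evaluating [P = 1] at 1, where [rev_first Theta] vanishes, leaves [alpha / k = 1]. *)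
have ak : alpha = k.
  move: (rev_first_at1 Theta_feasible);
    rewrite -(addrK ((alpha / k) *: 'X) (rev_first Theta)).
  by rewrite -/P PE !hornerE => /subr0_eq /esym /divr1_eq.
split=> //; rewrite -(addrK ((alpha / k) *: 'X) (rev_first Theta)) -/P PE.
by rewrite ak divff ?gt_eqF// scale1r /quad c0 expr0n scale0r subr0 mulr1.
Qed.

End Star.
End Rigidity.

(** * Closed forms of the optimal constants *)

Section Constants.
Variables (R : realType) (lmin lmax : R).
Hypotheses (lmin_gt0 : 0 < lmin) (lmin_le_lmax : lmin <= lmax).

Let sqrt_lmin_gt0 : 0 < Num.sqrt lmin.
Proof. by rewrite sqrtr_gt0. Qed.

Let sqrt_le : Num.sqrt lmin <= Num.sqrt lmax.
Proof. exact: ler_wsqrtr. Qed.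

Let sum_gt0 : 0 < Num.sqrt lmax + Num.sqrt lmin.
Proof. by rewrite ltr_wpDl ?sqrtr_ge0. Qed.

Lemma gamma_starE : gamma_star lmin lmax =
  (Num.sqrt lmax - Num.sqrt lmin) / (Num.sqrt lmax + Num.sqrt lmin).
Proof.
have lmax_ge0 : 0 <= lmax by exact: le_trans (ltW lmin_gt0) _.
rewrite /gamma_star sqrtrM// sqrtrV ?ltW//.
by field; rewrite !gt_eqF.
Qed.

Lemma gamma_star_ge0 : 0 <= gamma_star lmin lmax.
Proof. by rewrite gamma_starE divr_ge0 ?subr_ge0// ltW. Qed.

Lemma gamma_star_lt1 : gamma_star lmin lmax < 1.
Proof. by rewrite gamma_starE ltr_pdivrMr// mul1r; have := sqrt_lmin_gt0;
  lra. Qed.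

Lemma alpha_star_gt0 : 0 < alpha_star lmin lmax.
Proof. by rewrite divr_gt0 ?exprn_gt0. Qed.

(** The optimal Joukowski map sends [c] to [lmin] and, in [lmaxE], [- c] to [lmax]. *)
Lemma lminE : (1 - gamma_star lmin lmax) ^+ 2 / alpha_star lmin lmax = lmin.
Proof.
rewrite -[RHS]sqr_sqrtr ?ltW// gamma_starE /alpha_star.
by field; rewrite gt_eqF.
Qed.

Lemma lmaxE : (1 + gamma_star lmin lmax) ^+ 2 / alpha_star lmin lmax = lmax.
Proof.
have lmax_ge0 : 0 <= lmax by exact: le_trans (ltW lmin_gt0) _.
rewrite -[RHS]sqr_sqrtr// gamma_starE /alpha_star.
by field; rewrite gt_eqF.
Qed.

End Constants.

(** * Root moduli at the optimal parameters *)

Section StarRoots.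
Variable R : realType.

(** The discriminant is not positive, so [z] has real part [b]: from the imaginary part if [z] is
    not real, and as a double root otherwise. Then [|z|^2 = c^2]. *)
Lemma quadratic_root_le (b c : R) (z : R[i]) : - c <= b <= c ->
  z ^+ 2 - (2 * b)%:C * z + (c ^+ 2)%:C = 0 -> normc z <= c.
Proof.
move=> /andP[cb bc]; have c0 : 0 <= c by lra.
case: z => x y; rewrite expr2 => /eqP;
  rewrite eq_complex /= => /andP[/eqP re /eqP im].
rewrite -(ler_pXn2r (n := 2))// ?nnegrE ?sqrtr_ge0// sqr_sqrtr ?addr_ge0
  ?sqr_ge0//.
have {}re : x ^+ 2 - y ^+ 2 - 2 * b * x + c ^+ 2 = 0 by rewrite -[RHS]re; ring.
have {}im : y * (x - b) = 0.
  by apply: (mulfI (negbT (pnatr_eq0 R 2))); rewrite mulr0 -[RHS]im; ring.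
have xb : x = b.
  move/eqP: im; rewrite mulf_eq0 subr_eq0 => /orP[/eqP y0|/eqP//].
  apply/eqP; rewrite -subr_eq0 -sqrf_eq0 eq_le sqr_ge0 andbT.
  by move: re; rewrite y0 => re; nra.
by move: re; rewrite xb => re; lra.
Qed.

Variables (M : nat) (lmin lmax : R).
Hypotheses (lmin_gt0 : 0 < lmin) (lmin_le_lmax : lmin <= lmax).
Hypothesis M_ge1 : (1 <= M)%N.

Notation k := (alpha_star lmin lmax).
Notation c := (gamma_star lmin lmax).
Notation Theta := (Theta_star M lmin lmax).

Lemma Theta_star0 : Theta ord0 ord0 = c ^+ 2.
Proof. by rewrite mxE. Qed.

Let one : 'I_M.+1 := Ordinal (M_ge1 : (1 < M.+1)%N).

Lemma big_Theta_star (V : nmodType) (F : 'I_M.+1 -> R -> V) : (forall m, F m 0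
  = 0) ->
  \sum_(m < M.+1 | (0 < m)%N) F m (Theta ord0 m) = F one (- c ^+ 2).
Proof.
move=> F0; rewrite (bigD1 one)//= big1 ?addr0 ?mxE// => m /andP[m0 m1].
have {}m1 : m != 1%N :> nat by [].
by rewrite mxE (gtn_eqF m0) (negPf m1).
Qed.

Lemma Theta_star_feasible : feasible Theta.
Proof.
rewrite /feasible (bigD1 ord0)//= Theta_star0.
under eq_bigl do rewrite -lt0n.
by rewrite (big_Theta_star (F := fun _ x => x))// subrr.
Qed.

Lemma rev_first_star :
  rev_first Theta = (1 - 'X) * (1 - (c ^+ 2) *: 'X).
Proof.
rewrite /rev_first Theta_star0.
rewrite (big_Theta_star (F := fun m x => x *: 'X^(m.+1))) => [|m];
  last exact: scale0r.
rewrite /= -!mul_polyC rmorphD rmorphN rmorph1; ring.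
Qed.

(** The partial sums of [Theta] are [c^2] for one term and 0 from two terms on. *)
Lemma h_first_star : h_first Theta = 'X^M - (c ^+ 2) *: 'X^(M.-1).
Proof.
rewrite /h_first big_ltn ?ltnS//.
rewrite subn1 (bigD1 ord0)//= Theta_star0 [X in c ^+ 2 + X]big1 ?addr0;
  last first.
  by move=> m; rewrite ltnS leqn0 => /andP[/eqP m0]; rewrite -val_eqE /= m0.
rewrite big_nat_cond big1 ?addr0// => j; rewrite andbT => /andP[j1 jM].
rewrite (bigD1 ord0) /=; last by rewrite (ltn_trans _ j1).
rewrite Theta_star0 (bigD1 one) /=; last by rewrite j1.
rewrite mxE /= big1 ?addr0; first by rewrite subrr scale0r.
move=> m /andP[/andP[_ m0] m1]; rewrite mxE.
have {}m0 : m != 0%N :> nat by [].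
have {}m1 : m != 1%N :> nat by [].
by rewrite (negPf m0) (negPf m1).
Qed.

Lemma h_first_star_neq0 : h_first Theta != 0.
Proof.
rewrite h_first_star;
  apply: contra_neq (oner_neq0 R) => /(congr1 (fun p : {poly R} => p`_M)).
by rewrite coefB coefZ !coefXn eqxx -{1}(prednK M_ge1) gtn_eqF// mulr0 subr0
  coef0.
Qed.

Lemma rbar_h_first_star : rbar (h_first Theta) <= c.
Proof.
have c0 := gamma_star_ge0 lmin_gt0 lmin_le_lmax.
have c1 := gamma_star_lt1 lmin_gt0 lmin_le_lmax.
apply: rbar_le => // [|z]; first exact: h_first_star_neq0.
rewrite h_first_star /root rmorphB /= map_polyZ !map_polyXn hornerD hornerN
  hornerZ.
rewrite !hornerXn -{1}(prednK M_ge1) exprS -mulrBl mulf_eq0 expf_eq0.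
case/orP => [|/andP[_ /eqP ->]]; last by rewrite normc0.
rewrite subr_eq0 => /eqP ->; rewrite normc_real ger0_norm ?sqr_ge0//.
by rewrite expr2 ler_piMl// ltW.
Qed.

Lemma rbar_h_other_star lambda : lmin <= lambda <= lmax ->
  rbar (h_other k Theta lambda) <= c.
Proof.
move=> /andP[l1 l2].
have c0 := gamma_star_ge0 lmin_gt0 lmin_le_lmax.
have k0 := alpha_star_gt0 lmax lmin_gt0.
apply: rbar_le => // [|z rz]; first exact: h_other_neq0.
have [->|z0] := eqVneq z 0; first by rewrite normc0.
have w0 : z^-1 != 0 by rewrite invr_eq0.
(* This [b] comes from the linear coefficient of the quadratic factor; [lambda] in [[lmin, lmax]]
   translates to [- c <= b <= c]. *)
apply: (@quadratic_root_le ((1 + c ^+ 2 - k * lambda) / 2)).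
  have {}l1 : (1 - c) ^+ 2 <= lambda * k.
    by rewrite -ler_pdivrMr// lminE.
  have {}l2 : lambda * k <= (1 + c) ^+ 2.
    by rewrite -ler_pdivlMr// lmaxE.
  by apply/andP; split; lra.
have := h_other_rev k Theta lambda w0;
  rewrite invrK (rootP rz) mul0r rev_first_star.
rewrite rmorphM !rmorphB /= rmorph1 map_polyX map_polyZ map_polyX.
rewrite hornerM !hornerD !hornerN hornerZ hornerX hornerC =>
  /(congr1 (fun x => z ^+ 2 * x)).
rewrite mulr0 => ->; field.
by [].
Qed.

(** At [lambda = lmin] the quadratic factor is [(z - c)^2], so the bound [c] is reached. *)
Lemma rbar_h_other_star_lmin : c <= rbar (h_other k Theta lmin).
Proof.
have := gamma_star_ge0 lmin_gt0 lmin_le_lmax.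
have k0 := alpha_star_gt0 lmax lmin_gt0.
(* For [c = 0] the default value 0 of the maximum in [rbar] suffices. *)
rewrite le_eqVlt => /orP[/eqP <-|c0].
  rewrite /rbar; elim: (croots _) => [|z s IH]; first by rewrite big_nil.
  by rewrite big_cons le_max IH orbT.
have cC : c%:C != 0 :> R[i] by rewrite fmorph_eq0 gt_eqF.
have := @normc_le_rbar _ (h_other k Theta lmin) (c%:C) (h_other_neq0 _ _ _).
rewrite normc_real gtr0_norm//; apply.
rewrite -[c%:C]invrK; apply: root_h_other; first by rewrite invr_eq0.
have -> : k * lmin = (1 - c) ^+ 2.
  by rewrite mulrC -(congr1 ( *%R^~ k) (lminE lmin_gt0 lmin_le_lmax)) divfK
    ?gt_eqF.
rewrite rev_first_star.
rewrite rmorphM !rmorphB /= rmorph1 map_polyX map_polyZ map_polyX.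
rewrite hornerM !hornerD !hornerN hornerZ hornerX hornerC.
by field.
Qed.

End StarRoots.

(** * Laplacian spectra and the two-vertex graph *)

Section Graphs.
Variable R : realType.

Lemma size_croots (p : {poly R}) : p != 0 -> size (croots p) = (size p).-1.
Proof.
move=> p0; rewrite -(size_map_poly (real_complex R) p) /croots.
case: closed_field_poly_normal => s /= ->.
by rewrite size_scale ?size_prod_XsubC// lead_coef_eq0 map_poly_eq0.
Qed.

Lemma prod_croots (p : {poly R}) : p \is monic ->
  \prod_(z <- croots p) ('X - z%:P) = toC p.
Proof.
rewrite /croots; case: closed_field_poly_normal => s /= E pm.
by rewrite [RHS]E (monicP _) ?map_monic// scale1r.
Qed.

Lemma size_laplacian_spectrum N (G : wgraph R N) : size (laplacian_spectrum G)
  = N.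
Proof.
rewrite size_sort size_map size_croots ?size_char_poly//.
by rewrite monic_neq0 ?char_poly_monic.
Qed.

Lemma eigval_le N (G : wgraph R N) i j : (i <= j)%N -> (j < N)%N ->
  eigval G i <= eigval G j.
Proof.
move=> ij jN; rewrite /eigval.
apply: (sorted_leq_nth le_trans le_refl) => //.
- by rewrite sort_le_sorted.
- by rewrite inE size_laplacian_spectrum (leq_ltn_trans ij).
- by rewrite inE size_laplacian_spectrum.
Qed.

Lemma in_family_eigval lmin lmax N (G : wgraph R N) i :
  in_family lmin lmax G -> (0 < i < N)%N -> lmin <= eigval G i <= lmax.
Proof.
move=> [_ /(_ (eigval G i))] + /andP[i0 iN]; rewrite /= !in_itv /=; apply.
rewrite !eigval_le// ?ltn_predL ?(leq_ltn_trans _ iN)//.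
by rewrite -ltnS (ltn_predK iN).
Qed.

(** A single edge of weight [w] has the nonzero eigenvalue [2 w], so graphs with two vertices
    already realize every [lambda] of the interval. *)
Definition edge_adj (w : R) : 'M[R]_2 :=
  \matrix_(i, j) (if i == j then 0 else w).

Lemma edge_adj_diag w i : edge_adj w i i = 0.
Proof. by rewrite mxE eqxx. Qed.

Lemma edge_adj_sym w i j : edge_adj w i j = edge_adj w j i.
Proof. by rewrite !mxE eq_sym. Qed.

Lemma edge_adj_ge0 w : 0 <= w -> forall i j, 0 <= edge_adj w i j.
Proof. by move=> w0 i j; rewrite mxE; case: ifP. Qed.

Definition edge_graph (w : R) (w0 : 0 <= w) : wgraph R 2 :=
  WGraph (edge_adj_diag w) (edge_adj_sym w) (edge_adj_ge0 w0).

Lemma edge_graph_connected (w : R) (w0 : 0 < w) :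
  connected_graph (edge_graph (ltW w0)).
Proof.
move=> i j; have [->//|ij] := eqVneq i j.
by apply: connect1; rewrite /Defs.adjacent mxE (negPf ij).
Qed.

Lemma edge_graph_spectrum (w : R) (w0 : 0 < w) :
  laplacian_spectrum (edge_graph (ltW w0)) = [:: 0; 2 * w].
Proof.
have cp : char_poly (laplacian (edge_graph (ltW w0))) = 'X * ('X - (2 * w)%:P).
  rewrite /char_poly (expand_det_row _ ord0) !big_ord_recl big_ord0 addr0.
  rewrite /cofactor !det_mx11 !mxE !big_ord_recl !big_ord0 !mxE /=.
  rewrite !(mulr1n, mulr0n, addr0, add0r, subr0, sub0r).
  by rewrite expr0 expr1 -!polyCN; ring.
have pe : perm_eq (croots (char_poly (laplacian (edge_graph (ltW w0))))) [:: 0;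
  (2 * w)%:C].
  apply: prod_XsubC_eq; rewrite prod_croots ?char_poly_monic// cp.
  rewrite !big_cons big_nil mulr1 subr0 rmorphM /= map_polyX.
  by rewrite map_polyXsubC.
rewrite /laplacian_spectrum.
have /(perm_map (@complex.Re R))/perm_sort_leP -> := pe.
apply: sorted_sort; first exact: le_trans.
by rewrite /= andbT mulr_ge0// ltW.
Qed.

End Graphs.

(** * Worst-case rate: lower bound, uniqueness and optimal value *)

Lemma rbar_h_poly_le (R : realType) M alpha (Theta : 'rV[R]_M.+1) N
    (G : wgraph R N) i :
  rbar (h_poly alpha Theta G i) <= graph_rate alpha Theta G.
Proof. by rewrite /graph_rate (bigD1 i)//= le_max lexx. Qed.

Section Gamma.
Variables (R : realType) (lmin lmax : R).
Hypotheses (lmin_gt0 : 0 < lmin) (lmin_le_lmax : lmin <= lmax).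
Variable M : nat.
Implicit Types (alpha lambda : R) (Theta : 'rV[R]_M.+1).

Notation k := (alpha_star lmin lmax).
Notation c := (gamma_star lmin lmax).

Lemma edge_graph_in_family lambda (h : lmin <= lambda <= lmax) :
  exists2 G : wgraph R 2, in_family lmin lmax G & eigval G 1 = lambda.
Proof.
have l0 : 0 < lambda / 2.
  by case/andP: h => hl _; rewrite divr_gt0// (lt_le_trans lmin_gt0).
exists (edge_graph (ltW l0)); rewrite /in_family /eigval edge_graph_spectrum /=.
  split; first exact: edge_graph_connected.
  move=> x /=; rewrite !in_itv /= mulrC divfK ?pnatr_eq0//.
  by move=> /le_anti <-.
by rewrite mulrC divfK ?pnatr_eq0.
Qed.

Lemma rbar_h_other_le_gamma alpha Theta lambda : lmin <= lambda <= lmax ->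
  ((rbar (h_other alpha Theta lambda))%:E <= gamma lmin lmax alpha Theta)%E.
Proof.
move=> /edge_graph_in_family [G GF Gl].
apply: (@le_trans _ _ (graph_rate alpha Theta G)%:E).
  by have := rbar_h_poly_le alpha Theta G (@Ordinal 2 1 isT);
    rewrite lee_fin /h_poly /= Gl.
by apply: ereal_sup_ubound; exists 2%N, G.
Qed.

(** Through two-vertex graphs, a bound on [gamma] bounds the roots of [h_other] for all [lambda] of
    the interval, which is what rigidity needs. *)
Lemma optimal_parameters_unique alpha Theta : (1 <= M)%N -> feasible Theta ->
  (gamma lmin lmax alpha Theta <= c%:E)%E ->
  alpha = k /\ Theta = Theta_star M lmin lmax.
Proof.
move=> M1 fT gle.
have c0 := gamma_star_ge0 lmin_gt0 lmin_le_lmax.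
have c1 := gamma_star_lt1 lmin_gt0 lmin_le_lmax.
have k0 := alpha_star_gt0 lmax lmin_gt0.
have small lambda z : (1 - c) ^+ 2 / k <= lambda <= (1 + c) ^+ 2 / k ->
    root (toC (h_other alpha Theta lambda)) z -> normc z <= c.
  rewrite lminE// lmaxE// => hl rz.
  apply: le_trans (normc_le_rbar (h_other_neq0 _ _ _) rz) _.
  by rewrite -lee_fin (le_trans (rbar_h_other_le_gamma _ _ hl)).
have [-> rT] : alpha = k /\ rev_first Theta = (1 - 'X) * (1 - (c ^+ 2) *: 'X).
  move: c0; rewrite le_eqVlt => /orP[/eqP/esym|] c0.
    by apply: parameters_unique_eq0 => //; rewrite c0.
  by apply: parameters_unique_gt0 => //; exact: ltW.
by split=> //; apply: rev_first_inj; rewrite rT rev_first_star.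
Qed.

Lemma gamma_star_parameters : (1 <= M)%N ->
  gamma lmin lmax k (Theta_star M lmin lmax) = c%:E.
Proof.
move=> M1; apply/eqP; rewrite eq_le; apply/andP; split; last first.
  apply: (@le_trans _ _ (rbar (h_other k (Theta_star M lmin lmax) lmin))%:E).
    by rewrite lee_fin rbar_h_other_star_lmin.
  by apply: rbar_h_other_le_gamma; rewrite lexx.
apply: ge_ereal_sup => _ [N [G [N2 GF ->]]]; rewrite lee_fin /graph_rate.
elim/big_ind: _ => [|x y hx hy|i _]; first exact: gamma_star_ge0.
  by rewrite ge_max hx.
rewrite /h_poly; case: eqVneq => i0; first exact: rbar_h_first_star.
by apply: rbar_h_other_star => //; apply: (in_family_eigval GF);
  rewrite lt0n i0 ltn_ord.
Qed.

End Gamma.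

Theorem theorem5 (R : realType) (lmin lmax : R)
    (lmin_gt0 : 0 < lmin) (lmin_le_lmax : lmin <= lmax)
    (M : nat) (M_ge1 : (1 <= M)%N) :
  (forall (alpha : R) (Theta : 'rV[R]_M.+1),
     optimal lmin lmax alpha Theta <->
     alpha = alpha_star lmin lmax /\ Theta = Theta_star M lmin lmax)
  /\ gamma lmin lmax (alpha_star lmin lmax) (Theta_star M lmin lmax)
     = (gamma_star lmin lmax)%:E.
Proof.
have gE := gamma_star_parameters lmin_gt0 lmin_le_lmax M_ge1.
have fS := Theta_star_feasible lmin lmax M_ge1.
split=> // alpha Theta; split=> [[fT opt]|[-> ->]].
  by apply: optimal_parameters_unique => //; rewrite -gE opt.
split=> // alpha' Theta' fT'; rewrite gE leNgt; apply/negP => lt.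
(* A strictly better choice would, by uniqueness, be the starred one itself. *)
have [aE TE] := optimal_parameters_unique lmin_gt0 lmin_le_lmax M_ge1 fT' (ltW
  lt).
by move: lt; rewrite aE TE gE ltxx.
Qed.
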